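(* Let $d\ge 1$ and let $(\mathbb{Z},\sigma)$ be the connection graph whose underlying graph is the one-dimensional lattice $\mathbb{Z}$ (vertices $\mathbb{Z}$, edges $\{x,x+1\}$, all edge weights equal to $1$), with a connection $\sigma:E(\mathbb{Z})\to O(d)$. Let $H_t^{\sigma}=\exp(-t\mathcal{L}^{\sigma})$ be its connection heat kernel. Then for every $x\in\mathbb{Z}$ and every positive integer $a$: (1) $H_t^{\sigma}(x,x)=\sum_{k\ge 0}\frac{C_{2k}^{k}}{k!}\left(\frac{-t}{2}\right)^k I_{d\times d}$; (2) $H^{\sigma}_t(x,x+a)=(-1)^a \sum_{k\ge 0}\frac{C_{2k}^{k+a}}{k!} \left(-\frac{t}{2}\right)^k\sigma_{x,x+1}\sigma_{x+1,x+2}\cdots\sigma_{x+a-1,x+a}$ and $H^{\sigma}_t(x,x-a)=(-1)^a \sum_{k\ge 0}\frac{C_{2k}^{k+a}}{k!} \left(-\frac{t}{2}\right)^k\sigma_{x,x-1}\sigma_{x-1,x-2}\cdots\sigma_{x-(a-1),x-a}$.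
   Context: A connection on a graph assigns to each ordered pair of adjacent vertices $(u,v)$ a matrix $\sigma_{uv}\in O(d)$ with $\sigma_{vu}=\sigma_{uv}^{-1}$. For $(\mathbb{Z},\sigma)$ with unit weights every vertex has degree $2$, and the normalized connection Laplacian $\mathcal{L}^{\sigma}=I-(D^{\sigma})^{-1/2}A^{\sigma}(D^{\sigma})^{-1/2}$ acts on functions $f:\mathbb{Z}\to\mathbb{R}^d$ by $(\mathcal{L}^{\sigma}f)(x)=f(x)-\tfrac12\sigma_{x,x-1}f(x-1)-\tfrac12\sigma_{x,x+1}f(x+1)$. It is viewed as an infinite block matrix with $d\times d$ blocks indexed by $\mathbb{Z}\times\mathbb{Z}$ (diagonal blocks $I_{d\times d}$, block $(x,x\pm1)$ equal to $-\tfrac12\sigma_{x,x\pm1}$). The connection heat kernel is $H_t^{\sigma}=\exp(-t\mathcal{L}^{\sigma})=\sum_{k\ge0}\frac{(-t)^k}{k!}(\mathcal{L}^{\sigma})^k$, and $H_t^{\sigma}(x,y)$ denotes its $d\times d$ block in position $(x,y)$. $C_{m}^{j}$ denotes the binomial coefficient $\binom{m}{j}$, taken to be $0$ when $j>m$. *)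

(* Defs.v *)
From HB Require Import structures.
From mathcomp Require Import all_boot all_order all_algebra.
From mathcomp Require Import all_classical all_reals all_analysis.

Set Implicit Arguments.
Unset Strict Implicit.
Unset Printing Implicit Defensive.

Import Order.TTheory GRing.Theory Num.Theory.
Import numFieldNormedType.Exports.

Local Open Scope classical_set_scope.
Local Open Scope ring_scope.

Definition orthogonal_mx (R : realType) (d : nat) (Q : 'M[R]_d) : Prop :=
  Q^T *m Q = 1%:M /\ Q *m Q^T = 1%:M.

(* Only the values of sigma on adjacent ordered pairs are meaningful; the
   others are unconstrained and masked by adj in connection_adjacency. *)
Definition is_connection (R : realType) (d : nat) (V : Type) (adj : rel V)
    (sigma : V -> V -> 'M[R]_d) : Prop :=
  forall u v, adj u v ->
    orthogonal_mx (sigma u v) /\ sigma v u = invmx (sigma u v).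

Section BlockMatrices.
Variables (R : realType) (d : nat) (V : choiceType).

Definition block_mx_on := V -> V -> 'M[R]_d.

Definition bdiag (c : V -> R) : block_mx_on :=
  fun x y => if x == y then (c x)%:M else 0.

(* The sum over z is a finitely supported one: it is 0 by convention when
   infinitely many terms are nonzero, which never happens over a locally
   finite graph, where the matrices below have finitely supported rows. *)
Definition bmul (A B : block_mx_on) : block_mx_on :=
  fun x y => \sum_(z \in [set: V]) A x z *m B z y.

Fixpoint bexp (A : block_mx_on) (k : nat) : block_mx_on :=
  if k is k'.+1 then bmul A (bexp A k') else bdiag (fun=> 1).

Variables (adj : rel V) (w : V -> V -> R) (sigma : V -> V -> 'M[R]_d).

Definition degree (x : V) : R := \sum_(y \in [set y | adj x y]) w x y.

Definition connection_adjacency : block_mx_on :=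
  fun x y => if adj x y then w x y *: sigma x y else 0.

Definition normalized_laplacian : block_mx_on :=
  let Dinvsqrt := bdiag (fun x => (Num.sqrt (degree x))^-1) in
  fun x y => bdiag (fun=> 1) x y
             - bmul (bmul Dinvsqrt connection_adjacency) Dinvsqrt x y.

End BlockMatrices.

Arguments bdiag {R d V} c x y.

Definition exp_term (R : realType) (d : nat) (V : choiceType)
    (L : block_mx_on R d V) (t : R) (x y : V) : nat -> 'M[R]_d :=
  fun k => ((- t) ^+ k / k`!%:R) *: bexp L k x y.

(* Block (x, y) of exp (- t L). *)
Definition heat_kernel (R : realType) (d : nat) (V : choiceType)
    (L : block_mx_on R d V) (t : R) (x y : V) : 'M[R]_d :=
  limn (series (exp_term L t x y)).

Definition latticeZ_adj : rel int := fun x y => (y == x + 1) || (y == x - 1).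

Definition latticeZ_laplacian (R : realType) (d : nat)
    (sigma : int -> int -> 'M[R]_d) : block_mx_on R d int :=
  normalized_laplacian latticeZ_adj (fun _ _ => 1) sigma.

Definition binom_term (R : realType) (a : nat) (t : R) : nat -> R :=
  fun k => 'C((2 * k)%N, (k + a)%N)%:R / k`!%:R * (- (t / 2)) ^+ k.

Lemma latticeZ_degree (R : realType) (x : int) :
  degree latticeZ_adj (fun _ _ => 1 : R) x = 2.
Proof.
rewrite /degree.
have -> : [set y | latticeZ_adj x y] = [set` [:: x + 1; x - 1]].
  by apply/seteqP; split=> y /=; rewrite /latticeZ_adj !inE.
have u : uniq [:: x + 1; x - 1] by rewrite /= mem_seq1 (inj_eq (addrI x)).
rewrite -fsbig_seq // !big_cons big_nil /=.
by rewrite addr0.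
Qed.

Lemma bmul_bdiagl (R : realType) (d : nat) (V : choiceType) (c : V -> R)
    (A : block_mx_on R d V) x y : bmul (bdiag c) A x y = c x *: A x y.
Proof.
rewrite /bmul -(@fsbig_widen _ _ _ _ [set x])//=.
  by rewrite fsbig_set1 /bdiag eqxx mul_scalar_mx.
by move=> z [_ /eqP zx]; rewrite /= /bdiag eq_sym (negbTE zx) mul0mx.
Qed.

Lemma bmul_bdiagr (R : realType) (d : nat) (V : choiceType) (c : V -> R)
    (A : block_mx_on R d V) x y : bmul A (bdiag c) x y = c y *: A x y.
Proof.
rewrite /bmul -(@fsbig_widen _ _ _ _ [set y])//=.
  by rewrite fsbig_set1 /bdiag eqxx mul_mx_scalar.
by move=> z [_ /eqP zx]; rewrite /= /bdiag (negbTE zx) mulmx0.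
Qed.

Lemma latticeZ_laplacianE (R : realType) (d : nat)
    (sigma : int -> int -> 'M[R]_d) (x y : int) :
  latticeZ_laplacian sigma x y =
    if x == y then 1%:M
    else if latticeZ_adj x y then - (2^-1 *: sigma x y) else 0.
Proof.
rewrite /latticeZ_laplacian /normalized_laplacian bmul_bdiagr bmul_bdiagl.
rewrite !latticeZ_degree /connection_adjacency /bdiag scale1r.
have h : (Num.sqrt 2)^-1 * (Num.sqrt 2)^-1 = 2^-1 :> R.
  by rewrite -invfM -expr2 sqr_sqrtr.
have [<-|xy] := eqVneq x y.
  rewrite /latticeZ_adj -[X in X == x + 1]addr0 -[X in X == x - 1]addr0.
  by rewrite !(inj_eq (addrI x)) /= !scaler0 subr0.
by rewrite scalerA h sub0r; case: ifP => // _; rewrite scaler0 oppr0.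
Qed.

(* Main.v *)
Require Import Defs.
From mathcomp Require Import all_boot all_order all_algebra.
From mathcomp Require Import ring zify.
From mathcomp Require Import all_classical all_reals all_analysis.

Set Implicit Arguments.
Unset Strict Implicit.
Unset Printing Implicit Defensive.

Import Order.TTheory GRing.Theory Num.Theory.
Import numFieldNormedType.Exports.

Local Open Scope classical_set_scope.
Local Open Scope ring_scope.

(* A backtracking step cancels its own parallel transport, so every walk on Z
   from x to y transports like the straight one: block (x, y) of L^k is the
   transport along the segment from x to y times the corresponding entry of the
   k-th power of the scalar Laplacian 1 - (T + T^-1) / 2, T being the shift.
   Since this operator is - (T^(1/2) - T^(-1/2))^2 / 2, its powers are given by
   the binomial coefficients of order 2k, and the resulting exponential series
   is dominated by that of exp (2 |t|). *)

Lemma binSS n m :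
  'C(n.+2, m.+2) = ('C(n, m) + 2 * 'C(n, m.+1) + 'C(n, m.+2))%N.
Proof. by rewrite !binS; lia. Qed.

Lemma bin_doubleS n :
  'C(2 * n.+1, n.+1) = (2 * ('C(2 * n, n) + 'C(2 * n, n.+1)))%N.
Proof.
have -> : (2 * n.+1 = (2 * n).+2)%N by lia.
have bin_middle : 'C((2 * n).+1, n) = 'C((2 * n).+1, n.+1).
  by rewrite -[RHS]bin_sub; [congr 'C(_, _); lia | lia].
by rewrite binS bin_middle binS; lia.
Qed.

Lemma leq_bin_exp2 n m : ('C(n, m) <= 2 ^ n)%N.
Proof.
elim: n m => [|n IHn] [|m]; rewrite ?bin0 ?expn_gt0 // binS expnS mul2n -addnn.
exact: leq_add.
Qed.

Section LaplacianPowerCoef.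
Variable F : numFieldType.

(* The coefficient of z^a in (1 - (z + z^-1) / 2)^k. *)
Definition laplacian_power_coef (k a : nat) : F :=
  (-1) ^+ a / 2 ^+ k * 'C(2 * k, k + a)%:R.

Lemma laplacian_power_coef0 a : laplacian_power_coef 0 a = (a == 0)%:R.
Proof.
rewrite /laplacian_power_coef muln0 add0n bin0n expr0 divr1.
by case: a => [|a]; rewrite ?mulr1 ?mulr0.
Qed.

Lemma laplacian_power_coefS0 k :
  laplacian_power_coef k.+1 0 =
    laplacian_power_coef k 0 - laplacian_power_coef k 1.
Proof.
rewrite /laplacian_power_coef !addn0 addn1 bin_doubleS !exprS.
by field; rewrite expf_neq0.
Qed.

Lemma laplacian_power_coefSS k a :
  laplacian_power_coef k.+1 a.+1 =
    laplacian_power_coef k a.+1 -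
      2^-1 * (laplacian_power_coef k a + laplacian_power_coef k a.+2).
Proof.
rewrite /laplacian_power_coef.
have -> : 'C(2 * k.+1, k.+1 + a.+1) = 'C((2 * k).+2, (k + a).+2).
  by congr 'C(_, _); lia.
rewrite binSS !addnS !exprS.
by field; rewrite expf_neq0.
Qed.

End LaplacianPowerCoef.

Section Transport.
Variables (R : pzRingType) (d : nat) (V : Type) (sigma : V -> V -> 'M[R]_d).

Definition transport (p : nat -> V) (n : nat) : 'M[R]_d :=
  \big[mulmx/1%:M]_(i < n) sigma (p i) (p i.+1).

Lemma transport0 p : transport p 0 = 1%:M.
Proof. exact: big_ord0. Qed.

Lemma transportS p n :
  transport p n.+1 = sigma (p 0) (p 1) *m transport (p \o succn) n.
Proof. exact: big_ord_recl. Qed.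

Lemma eq_transport p q n : p =1 q -> transport p n = transport q n.
Proof. by move=> pq; apply: eq_bigr => i _; rewrite !pq. Qed.

End Transport.

Lemma connection_mulV (R : realType) (d : nat) (V : Type) (adj : rel V)
    (sigma : V -> V -> 'M[R]_d) u v :
  is_connection adj sigma -> adj u v -> sigma u v *m sigma v u = 1%:M.
Proof.
move=> hsigma /hsigma [[_ ortho] ->].
by apply: mulmxV; have [] := mulmx1_unit ortho.
Qed.

Lemma bmul_seq (R : realType) (d : nat) (V : choiceType)
    (A B : block_mx_on R d V) (x y : V) (r : seq V) :
  uniq r -> (forall z, z \notin r -> A x z = 0) ->
  bmul A B x y = \sum_(z <- r) A x z *m B z y.
Proof.
move=> r_uniq A0; rewrite /bmul (fsbigE r) //=.
  by apply: eq_bigl => z; rewrite in_setT.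
by move=> z _ /A0 ->; rewrite mul0mx.
Qed.

Definition ray (x s : int) (i : nat) : int := x + s * i%:Z.

Lemma ray0 x s : ray x s 0 = x.
Proof. by rewrite /ray mulr0 addr0. Qed.

Lemma rayS x s i : ray x s i.+1 = ray (x + s) s i.
Proof. by rewrite /ray intS mulrDr mulr1 addrA. Qed.

Lemma ex_ray x y : exists2 s, `|s|%N = 1 & y = ray x s `|y - x|.
Proof.
have [yx|xy] := leP x y; first by exists 1 => //; rewrite /ray; lia.
by exists (-1) => //; rewrite /ray; lia.
Qed.

Lemma transport_rayS (R : pzRingType) (d : nat) (sigma : int -> int -> 'M[R]_d)
    x s n :
  transport sigma (ray x s) n.+1 =
    sigma x (x + s) *m transport sigma (ray (x + s) s) n.
Proof.
rewrite transportS rayS !ray0; congr (_ *m _).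
by apply: eq_transport => i /=; rewrite rayS.
Qed.

Lemma latticeZ_adj_unit x s : `|s|%N = 1 -> latticeZ_adj x (x + s).
Proof. by rewrite /latticeZ_adj; lia. Qed.

Section LatticeLaplacian.
Variables (R : realType) (d : nat) (sigma : int -> int -> 'M[R]_d).
Local Notation L := (latticeZ_laplacian sigma).

Lemma bmul_latticeZ_laplacian (B : block_mx_on R d int) (s x y : int) :
  `|s|%N = 1 ->
  bmul L B x y = B x y -
    2^-1 *: (sigma x (x + s) *m B (x + s) y + sigma x (x - s) *m B (x - s) y).
Proof.
move=> s_unit; rewrite (@bmul_seq _ _ _ _ _ _ _ [:: x; x + s; x - s]).
- have neq_neighbour u : `|u|%N = 1 -> (x == x + u) = false by lia.
  have Ns_unit : `|- s|%N = 1 by rewrite abszN.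
  rewrite !big_cons big_nil addr0 !latticeZ_laplacianE eqxx mul1mx.
  rewrite !neq_neighbour // !latticeZ_adj_unit //.
  by rewrite !mulNmx -!scalemxAl -opprD -scalerDr.
- by rewrite /= !inE; lia.
- move=> z; rewrite !inE latticeZ_laplacianE /latticeZ_adj => zx.
  by rewrite !ifF //; lia.
Qed.

Hypothesis hsigma : is_connection latticeZ_adj sigma.

Lemma transport_ray_backtrack x s n : `|s|%N = 1 ->
  sigma x (x - s) *m transport sigma (ray (x - s) s) n.+1 =
    transport sigma (ray x s) n.
Proof.
move=> s_unit; rewrite transport_rayS subrK mulmxA.
by rewrite (connection_mulV hsigma) ?mul1mx // latticeZ_adj_unit // abszN.
Qed.

Lemma bexp_latticeZ_laplacian k x s a : `|s|%N = 1 ->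
  bexp L k x (ray x s a) =
    laplacian_power_coef R k a *: transport sigma (ray x s) a.
Proof.
elim: k x s a => [|k IHk] x s a s_unit.
  rewrite /= /bdiag laplacian_power_coef0.
  have -> : (x == ray x s a) = (a == 0) by rewrite /ray; lia.
  by case: eqP => [->|_]; rewrite ?transport0 ?scale1r ?scale0r.
have Ns_unit : `|- s|%N = 1 by rewrite abszN.
rewrite [LHS](bmul_latticeZ_laplacian (bexp L k) _ _ s_unit) IHk //.
case: a => [|a].
  have x_from_fwd : ray x s 0 = ray (x + s) (- s) 1 by rewrite /ray; lia.
  have x_from_bwd : ray x s 0 = ray (x - s) s 1 by rewrite /ray; lia.
  rewrite {1}x_from_fwd {1}x_from_bwd !IHk // -!scalemxAr.
  rewrite transport_ray_backtrack //.
  have := transport_ray_backtrack x 0 Ns_unit; rewrite opprK => ->.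
  rewrite !transport0 laplacian_power_coefS0 -scalerDl scalerA -scalerBl.
  by congr (_ *: _); field.
have y_from_bwd : ray x s a.+1 = ray (x - s) s a.+2 by rewrite /ray; lia.
rewrite {1}rayS {1}y_from_bwd !IHk // -!scalemxAr -transport_rayS.
rewrite transport_ray_backtrack // laplacian_power_coefSS.
by rewrite -scalerDl scalerA -scalerBl.
Qed.

Lemma exp_term_latticeZ_laplacian (t : R) x s a : `|s|%N = 1 ->
  exp_term L t x (ray x s a) =
    fun k => binom_term a t k *: ((-1) ^+ a *: transport sigma (ray x s) a).
Proof.
move=> s_unit; apply/funext => k.
rewrite /exp_term bexp_latticeZ_laplacian // !scalerA.
rewrite /laplacian_power_coef /binom_term -mulNr exprMn exprVn.
by congr (_ *: _); ring.
Qed.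

End LatticeLaplacian.

Section BinomialSeries.
Variables (R : realType) (a : nat) (t : R).

Lemma normr_binom_term_le k : `|binom_term a t k| <= exp_coeff (2 * `|t|) k.
Proof.
have -> : exp_coeff (2 * `|t|) k = 4 ^+ k / k`!%:R * (`|t| / 2) ^+ k.
  rewrite /exp_coeff /= mulrAC -exprMn.
  by congr (_ ^+ _ / _); field.
rewrite /binom_term !normrM normrX normrN normrM !normfV !normr_nat.
rewrite ler_wpM2r ?exprn_ge0 ?divr_ge0 // ler_wpM2r ?invr_ge0 //.
by rewrite -natrX ler_nat (leq_trans (leq_bin_exp2 _ _)) // expnM.
Qed.

Lemma is_cvg_series_binom_term : cvgn (series (binom_term a t)).
Proof.
apply: normed_cvg; apply: series_le_cvg normr_binom_term_le _ => //=.
- by move=> k; rewrite exp_coeff_ge0 // mulr_ge0.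
- exact: is_cvg_series_exp_coeff.
Qed.

End BinomialSeries.

Lemma cvg_series_scalel (K : numFieldType) (V : normedModType K) (u : K ^nat)
    (l : K) (v : V) :
  series u @ \oo --> l -> series (fun k => u k *: v) @ \oo --> l *: v.
Proof.
move=> ul; have -> : series (fun k => u k *: v) = fun n => series u n *: v.
  by apply/funext => n; rewrite /series /= scaler_suml.
exact: cvgZr_tmp.
Qed.

Lemma cvg_series_exp_term_latticeZ (R : realType) (d : nat)
    (sigma : int -> int -> 'M[R]_d) (t : R) (x s : int) (a : nat) :
  (0 < d)%N -> is_connection latticeZ_adj sigma -> `|s|%N = 1 ->
  series (exp_term (latticeZ_laplacian sigma) t x (ray x s a)) @ \oo -->
    ((-1) ^+ a * limn (series (binom_term a t))) *:
      transport sigma (ray x s) a.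
Proof.
(* The normed space structure on square matrices requires a positive size. *)
case: d sigma => // d sigma _ hsigma s_unit.
rewrite exp_term_latticeZ_laplacian // mulrC -scalerA.
by apply: cvg_series_scalel; exact: is_cvg_series_binom_term.
Qed.

Lemma heat_kernel_latticeZ (R : realType) (d : nat)
    (sigma : int -> int -> 'M[R]_d) (t : R) (x s : int) (a : nat) :
  (0 < d)%N -> is_connection latticeZ_adj sigma -> `|s|%N = 1 ->
  heat_kernel (latticeZ_laplacian sigma) t x (ray x s a) =
    ((-1) ^+ a * limn (series (binom_term a t))) *:
      transport sigma (ray x s) a.
Proof.
move=> d_gt0 hsigma s_unit; apply: cvg_lim => //.
exact: cvg_series_exp_term_latticeZ.
Qed.

Theorem theorem1 (R : realType) (d : nat) (hd : (1 <= d)%N)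
    (sigma : int -> int -> 'M[R]_d) (hsigma : is_connection latticeZ_adj sigma)
    (t : R) (x : int) :
  let L := latticeZ_laplacian sigma in
  let H := heat_kernel L t in
  [/\ (forall y : int, cvgn (series (exp_term L t x y))),
      (forall a : nat, cvgn (series (binom_term a t))),
      H x x = limn (series (binom_term 0 t)) *: 1%:M
    & forall a : nat, (0 < a)%N ->
        H x (x + a%:Z) =
          ((-1) ^+ a * limn (series (binom_term a t))) *:
            \big[mulmx/1%:M]_(i < a) sigma (x + i%:Z) (x + i.+1%:Z)
        /\
        H x (x - a%:Z) =
          ((-1) ^+ a * limn (series (binom_term a t))) *:
            \big[mulmx/1%:M]_(i < a) sigma (x - i%:Z) (x - i.+1%:Z)].
Proof.
move=> /=.
have ray1 i : ray x 1 i = x + i%:Z by rewrite /ray mul1r.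
have rayN1 i : ray x (-1) i = x - i%:Z by rewrite /ray mulN1r.
split.
- move=> y; have [s s_unit ->] := ex_ray x y.
  by apply/cvg_ex; eexists; exact: cvg_series_exp_term_latticeZ.
- by move=> a; exact: is_cvg_series_binom_term.
- rewrite -[X in heat_kernel _ _ _ X](ray0 x 1) heat_kernel_latticeZ //.
  by rewrite transport0 mul1r.
- move=> a _; rewrite -ray1 -rayN1 !heat_kernel_latticeZ //.
  split; congr (_ *: _).
    exact: eq_transport ray1.
  exact: eq_transport rayN1.
Qed.
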